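(* Let $a,b,c$ be complex numbers and, for integers $n\ge0$, $$\chi_n(a,b,c):=\sum_{k=0}^{n-1}q^k\frac{(abc;q^3)_k(b,c;q)_k}{(bc/q^2;q)_{2k+2}(aq;q)_k}.$$ Then for every integer $n\ge0$ (whenever no denominator vanishes) $$\chi_n(a,b,c)=\frac{(1-abc)(1-aq^3/b)(1-aq^3/c)}{(aq;q)_3}\chi_n(aq^3,b,c)+\frac{aq^3}{bc(aq;q)_2}\left\{1-\frac{(abc;q^3)_n(b,c;q)_n}{(bc/q^2;q)_{2n}(aq^3;q)_n}\right\}.$$
   Context: $q$ is a complex number with $|q|<1$. For a base $p$ and integer $k\ge0$, $(z;p)_k:=\prod_{j=0}^{k-1}(1-zp^j)$, and $(z_1,\dots,z_m;p)_k:=(z_1;p)_k\cdots(z_m;p)_k$. *)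

(* Defs.v *)
From mathcomp Require Import all_boot all_order all_algebra.
From mathcomp Require Import complex.
From mathcomp Require Import reals.

Set Implicit Arguments.
Unset Strict Implicit.
Unset Printing Implicit Defensive.

Import Order.TTheory GRing.Theory Num.Theory.
Local Open Scope ring_scope.

Definition qpoch (F : fieldType) (z p : F) (k : nat) : F :=
  \prod_(j < k) (1 - z * p ^+ j).

Definition qpochs (F : fieldType) (zs : seq F) (p : F) (k : nat) : F :=
  \prod_(z <- zs) qpoch z p k.

Definition chi_den (F : fieldType) (q a b c : F) (k : nat) : F :=
  qpoch (b * c / q ^+ 2) q (2 * k + 2) * qpoch (a * q) q k.

Definition chi (F : fieldType) (q : F) (n : nat) (a b c : F) : F :=
  \sum_(k < n)
     q ^+ k * (qpoch (a * b * c) (q ^+ 3) k * qpochs [:: b; c] q k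
               / chi_den q a b c k).

(* Main.v *)
Require Import Defs.
From mathcomp Require Import all_boot all_order all_algebra.
From mathcomp Require Import complex.
From mathcomp Require Import reals.
From mathcomp Require Import ring.

Import Order.TTheory GRing.Theory Num.Theory.
Local Open Scope ring_scope.

(** The identity telescopes termwise. Write [t_k(a)] for the summand of
    [chi], [U_k] for the quotient in the last braces, and let [C], [K] be the
    two prefactors. Then [t_k(a) - C t_k(a q^3) = K (U_k - U_{k+1})]: after the
    factors [(abc;q^3)_k (b,c;q)_k / ((bc/q^2;q)_{2k} (aq;q)_k)] common to all
    four terms are removed, this is a rational identity in [a, b, c, q] and
    [x = q^k]. *)

Section Contiguous.
Variable F : fieldType.
Implicit Types (q a b c z p : F) (k m n : nat).

Lemma qpoch0 z p : qpoch z p 0 = 1.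
Proof. by rewrite /qpoch big_ord0. Qed.

Lemma qpochS z p k : qpoch z p k.+1 = qpoch z p k * (1 - z * p ^+ k).
Proof. by rewrite /qpoch big_ord_recr. Qed.

Lemma qpochD z p m k :
  qpoch z p (m + k) = qpoch z p m * qpoch (z * p ^+ m) p k.
Proof.
elim: k => [|k IHk]; first by rewrite addn0 qpoch0 mulr1.
by rewrite addnS !qpochS IHk mulrA exprD -[z * p ^+ m * _]mulrA.
Qed.

Lemma qpoch1 z p : qpoch z p 1 = 1 - z.
Proof. by rewrite qpochS qpoch0 expr0 mul1r mulr1. Qed.

Lemma qpochs2 (y z p : F) k : qpochs [:: y; z] p k = qpoch y p k * qpoch z p k.
Proof. by rewrite /qpochs !big_cons big_nil mulr1. Qed.

(** This is [U_k]; its value 1 at [k = 0] produces the constant 1 in the braces. *)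
Definition chi_bdry q a b c k :=
  qpoch (a * b * c) (q ^+ 3) k * qpochs [:: b; c] q k
    / (qpoch (b * c / q ^+ 2) q (2 * k) * qpoch (a * q ^+ 3) q k).

Lemma chiS q n a b c :
  chi q n.+1 a b c = chi q n a b c
    + q ^+ n * (qpoch (a * b * c) (q ^+ 3) n * qpochs [:: b; c] q n
                / chi_den q a b c n).
Proof. by rewrite /chi big_ord_recr. Qed.

(** Once the prefactors are absorbed, [(aq;q)_{k+3}] and [(bc/q^2;q)_{2k+2}] are the longest
    denominator products in the four terms, hence the last two hypotheses. *)
Lemma chi_term_telescope q a b c k :
  q != 0 -> b != 0 -> c != 0 ->
  qpoch (a * q) q k.+3 != 0 -> qpoch (b * c / q ^+ 2) q (2 * k.+1) != 0 ->
  q ^+ k * (qpoch (a * b * c) (q ^+ 3) k * qpochs [:: b; c] q k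
            / chi_den q a b c k) =
  (1 - a * b * c) * (1 - a * q ^+ 3 / b) * (1 - a * q ^+ 3 / c)
    / qpoch (a * q) q 3
    * (q ^+ k * (qpoch (a * q ^+ 3 * b * c) (q ^+ 3) k * qpochs [:: b; c] q k
                 / chi_den q (a * q ^+ 3) b c k))
  + a * q ^+ 3 / (b * c * qpoch (a * q) q 2)
    * (chi_bdry q a b c k - chi_bdry q a b c k.+1).
Proof.
move=> q0 b0 c0 A0 D0.
(* The prefactors supply the initial factors missing from shifted symbols: [1 - abc] for
   [(abcq^3;q^3)_k], [(aq;q)_3] for [(aq^4;q)_k], [(aq;q)_2] for [(aq^3;q)_k]. *)
have eP : (1 - a * b * c) * qpoch (a * q ^+ 3 * b * c) (q ^+ 3) k
    = qpoch (a * b * c) (q ^+ 3) k * (1 - a * b * c * (q ^+ k) ^+ 3).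
  rewrite -exprM mulnC exprM -qpochS -(add1n k) qpochD qpoch1 expr1.
  by congr (_ * qpoch _ _ _); ring.
have eA3 : qpoch (a * q) q 3 * qpoch (a * q ^+ 3 * q) q k
    = qpoch (a * q) q k.+3.
  by rewrite -[k.+3]/(3 + k)%N qpochD; congr (_ * qpoch _ _ _); ring.
have eA2 j : qpoch (a * q) q 2 * qpoch (a * q ^+ 3) q j
    = qpoch (a * q) q j.+2.
  by rewrite -[j.+2]/(2 + j)%N qpochD; congr (_ * qpoch _ _ _); ring.
(* Inversion is multiplicative even at 0, so bringing the paired factors together has no side
   conditions. *)
have lin : forall r s t u v w y z : F,
    r * s * t / u * (v * (w * y / (z))) = s * t * v * (r * w) * y / (u * z).
  by move=> *; rewrite invfM; ring.
have linb : forall r s t u v w : F,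
    r / (s * t) * (u / (v * w)) = r / s * u / (v * (t * w)).
  by move=> *; rewrite !invfM; ring.
rewrite [a * q ^+ 3 / (b * c * _) * _]mulrBr /chi_bdry /chi_den lin eP !linb !eA2.
rewrite [qpoch (a * q) q 3 * _]mulrCA eA3.
move: A0 D0; rewrite !mulnS !qpochs2 !(addnC 2) !addn2 !qpochS.
rewrite !(exprS q k.+1) !(exprS q k) !(exprS q (2 * k)).
have -> : q ^+ (2 * k) = (q ^+ k) ^+ 2 by rewrite -exprM mulnC.
have -> : (q ^+ 3) ^+ k = (q ^+ k) ^+ 3 by rewrite -!exprM mulnC.
move: (qpoch (a * b * c) _ k) (qpoch b q k) (qpoch c q k) => P B C.
(* Trading [c] for a free parameter [d] turns the side conditions of [field] into the factors [D],
   [1 - d x^2], [1 - d q x^2] split off from the hypothesis. *)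
have [d d_def] : exists d, d = b * c / q ^+ 2 by exists (b * c / q ^+ 2).
rewrite -d_def; move: (qpoch d q _) (qpoch (a * q) q k) (q ^+ k) => D A x.
have c_def : c = d * q ^+ 2 / b by rewrite d_def; field; apply/andP.
have d0 : d != 0 by rewrite d_def !mulf_neq0 // invr_eq0 expf_neq0.
rewrite c_def !mulf_eq0 !negb_or -!andbA.
case/and4P=> A0 A1 A2 A3 /and3P[D0 D1 D2].
by field; do ![apply/andP; split].
Qed.

Lemma qpoch_neq0_le z p m n :
  (m <= n)%N -> qpoch z p n != 0 -> qpoch z p m != 0.
Proof.
by move=> /subnKC <-; rewrite qpochD mulf_eq0 negb_or => /andP[].
Qed.

(** Summing the termwise relation leaves [U_0 - U_n]. The indices [n.+2] and [2 * n] are those of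
    the termwise hypotheses at the last summand [k = n - 1]. *)
Lemma chi_contiguous q a b c n :
  q != 0 -> b != 0 -> c != 0 ->
  qpoch (a * q) q n.+2 != 0 -> qpoch (b * c / q ^+ 2) q (2 * n) != 0 ->
  chi q n a b c =
  (1 - a * b * c) * (1 - a * q ^+ 3 / b) * (1 - a * q ^+ 3 / c)
    / qpoch (a * q) q 3 * chi q n (a * q ^+ 3) b c
  + a * q ^+ 3 / (b * c * qpoch (a * q) q 2) * (1 - chi_bdry q a b c n).
Proof.
move=> q0 b0 c0; elim: n => [|n IHn] A0 D0.
  rewrite /chi !big_ord0 /chi_bdry qpochs2 muln0 !qpoch0 !mulr1 divr1 subrr.
  by rewrite !mulr0 addr0.
rewrite !chiS IHn; first last.
- by apply: qpoch_neq0_le D0; rewrite leq_mul2l leqnSn orbT.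
- exact: qpoch_neq0_le A0.
rewrite chi_term_telescope //.
move: (_ / qpoch _ _ 3) (_ / (b * c * _)) => C K.
ring.
Qed.

End Contiguous.

Theorem theorem3p4 (R : realType) (q a b c : R[i]) (n : nat)
  (hq : `|q| < 1)
  (q_neq0 : q != 0) (b_neq0 : b != 0) (c_neq0 : c != 0)
  (den_lhs : forall k : nat, (k < n)%N -> chi_den q a b c k != 0)
  (den_rhs : forall k : nat, (k < n)%N -> chi_den q (a * q ^+ 3) b c k != 0)
  (den_coef1 : qpoch (a * q) q 3 != 0)
  (den_coef2 : b * c * qpoch (a * q) q 2 != 0)
  (den_last :
     qpoch (b * c / q ^+ 2) q (2 * n) * qpoch (a * q ^+ 3) q n != 0) :
  chi q n a b c =
    (1 - a * b * c) * (1 - a * q ^+ 3 / b) * (1 - a * q ^+ 3 / c)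
      / qpoch (a * q) q 3 * chi q n (a * q ^+ 3) b c
    + a * q ^+ 3 / (b * c * qpoch (a * q) q 2)
      * (1 - qpoch (a * b * c) (q ^+ 3) n * qpochs [:: b; c] q n
             / (qpoch (b * c / q ^+ 2) q (2 * n) * qpoch (a * q ^+ 3) q n)).
Proof.
move: den_last; rewrite mulf_eq0 negb_or => /andP[D0 A0].
apply: chi_contiguous => //; move: den_coef2.
rewrite mulf_eq0 negb_or => /andP[_ A2].
(* In [(aq;q)_{n+2} = (aq;q)_2 (aq^3;q)_n] the factors are nonzero by [den_coef2] and [den_last]. *)
rewrite -[n.+2]/(2 + n)%N qpochD mulf_eq0 negb_or A2.
by rewrite -mulrA -exprS.
Qed.
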